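(* Let $n \geq 3$ be an odd integer, let $m \geq 3$ be an odd integer, and let $v = m(n+1)$. Then for every integer $\ell$ with $0 \leq \ell \leq \frac{m-1}{2}$, setting $$r = 2n\ell + (m+n-1), \qquad s = (n+1)\left(\tfrac{m-1}{2}-\ell\right),$$ there exists a $(K_2,K_{1,n})$-$URD(K_v;r,s)$.
   Context: $K_v$ is the complete graph on $v$ vertices, and $K_{1,n}$ is the star with one center and $n$ leaves (it has $n+1$ vertices). For a graph $G$ and graphs $H_1,H_2$, an $(H_1,H_2)$-$URD(G;r,s)$ (uniformly resolvable decomposition) is a collection of pairwise edge-disjoint subgraphs of $G$ (called blocks), each isomorphic to $H_1$ or $H_2$, such that every edge of $G$ lies in exactly one block, together with a partition of the blocks into $r+s$ classes (factors), where each class consists of pairwise vertex-disjoint blocks that together cover all vertices of $G$ (i.e. the class is a spanning subgraph of $G$), $r$ of the classes consist only of copies of $H_1$, and $s$ of the classes consist only of copies of $H_2$. *)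

(* Defs.v *)
From mathcomp Require Import all_boot.

Set Implicit Arguments.
Unset Strict Implicit.
Unset Printing Implicit Defensive.

Record sgraph := SGraph {
  vertex :> finType;
  adj : rel vertex;
  adj_sym : symmetric adj;
  adj_irrefl : irreflexive adj
}.

Arguments adj {s} x y.

Definition edges (G : sgraph) : {set {set G}} :=
  [set [set x; y] | x in [set: G], y in [set: G] & adj x y].

Definition complete_adj (T : finType) (x y : T) : bool := x != y.

Lemma complete_adj_sym (T : finType) : symmetric (@complete_adj T).
Proof. by move=> x y; rewrite /complete_adj eq_sym. Qed.

Lemma complete_adj_irrefl (T : finType) : irreflexive (@complete_adj T).
Proof. by move=> x; rewrite /complete_adj eqxx. Qed.

Definition complete_graph (v : nat) : sgraph :=
  SGraph (@complete_adj_sym 'I_v) (@complete_adj_irrefl 'I_v).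

(* The center is [ord0]; exactly one endpoint of each edge is the center. *)
Definition star_adj (n : nat) (x y : 'I_n.+1) : bool :=
  (x == ord0) (+) (y == ord0).

Lemma star_adj_sym n : symmetric (@star_adj n).
Proof. by move=> x y; rewrite /star_adj addbC. Qed.

Lemma star_adj_irrefl n : irreflexive (@star_adj n).
Proof. by move=> x; rewrite /star_adj addbb. Qed.

Definition star_graph (n : nat) : sgraph :=
  SGraph (@star_adj_sym n) (@star_adj_irrefl n).

(* A candidate subgraph, as the pair of its vertex set and its edge set; being *)
(* an actual subgraph of [G] is [is_subgraph].                                 *)
Definition block (G : sgraph) : Type := ({set G} * {set {set G}})%type.

Definition is_subgraph (G : sgraph) (B : block G) : Prop :=
  B.2 \subset edges G /\ (forall e : {set G}, e \in B.2 -> e \subset B.1).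

Definition isomorphic_to (G H : sgraph) (B : block G) : Prop :=
  exists f : H -> G,
    [/\ injective f,
        B.1 = [set f x | x : H]
      & B.2 = [set f @: e | e : {set H} in edges H]].

Definition is_factor (G : sgraph) (C : {set block G}) : Prop :=
  (forall B B', B \in C -> B' \in C -> B != B' -> [disjoint B.1 & B'.1]) /\
  \bigcup_(B in C) B.1 = [set: G].

Definition is_decomposition (G H1 H2 : sgraph) (D : {set block G}) : Prop :=
  [/\ forall B, B \in D -> is_subgraph B,
      forall B, B \in D -> isomorphic_to H1 B \/ isomorphic_to H2 B,
      forall B B', B \in D -> B' \in D -> B != B' -> [disjoint B.2 & B'.2]
    & forall e, e \in edges G -> exists! B, B \in D /\ e \in B.2].

(* [P1] and [P2] are the sets of classes consisting of copies of [H1] and of   *)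
(* [H2] respectively.                                                          *)
Definition URD (H1 H2 G : sgraph) (r s : nat) : Prop :=
  exists (D : {set block G}) (P1 P2 : {set {set block G}}),
    [/\ is_decomposition H1 H2 D,
        partition (P1 :|: P2) D /\ [disjoint P1 & P2],
        forall C, C \in P1 :|: P2 -> is_factor C,
        #|P1| = r /\
          (forall C B, C \in P1 -> B \in C -> isomorphic_to H1 B)
      & #|P2| = s /\
          (forall C B, C \in P2 -> B \in C -> isomorphic_to H2 B)].

(* Main.v *)
Require Import Defs.
From mathcomp Require Import all_boot all_algebra all_fingroup cyclic zify.

Set Implicit Arguments.
Unset Strict Implicit.
Unset Printing Implicit Defensive.

(** Put the vertices on a grid X x J, where X is the group of integers mod m and
    J has N = n + 1 elements, an even number. Since m is odd, the nonzero
    elements of X split into (m - 1)/2 pairs {delta d, - delta d}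
    ([half_system_ord]); since N is even, the complete graph on J has a
    one-factorization M, which adds a point to an odd group
    ([one_factorization_option]). The edges of the grid are of two kinds.

    - Slanted edges, where both coordinates differ. Those with column difference
      delta d or - delta d can be decomposed in two ways. As stars: for each row
      c, the star at (x, c) has as leaves all the (x + delta d, j) with j <> c;
      these m stars form a factor, since in each column the centre fills the one
      place that the leaves leave free. This gives N star factors. As matchings:
      for each matching M k of J, the edges from (x, j) to (x + delta d, M k j),
      with j running over one chosen end of each edge of M k, form a
      one-factor; exchanging the ends gives another. This gives 2n one-factors.
      The matchings are used for l of the differences, the stars for the others.

    - Edges inside a row or a column. These form the Cartesian product of the
      complete graphs on X and J. The reflections x |-> a - x are the m
      near-one-factors of X, each with one fixed column; that column is filled
      with a copy of one fixed matching M k0. The n - 1 other matchings of J,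
      each repeated in all columns, cover what is left. This gives m + n - 1
      one-factors, whatever the value of l.

    The stars alone would leave, for each difference, odd cycles inside the
    rows, which have no one-factorization; keeping the rows of all differences
    together with the columns is what removes this parity obstruction.

    A factor is encoded by the map that sends each vertex to the centre of its
    star, a matching being a factor into stars with one leaf. Then
    [URD_of_centrings] turns a family of such maps, in which each pair of
    vertices is joined exactly once, into a decomposition, and
    [centre_map_exact_cover] is the exact covering for the family above. *)

(** * Star factors as maps to the centre *)

Definition fibre (T : finType) (g : T -> T) (c : T) : {set T} :=
  [set x | g x == c].

(** Encodes a partition of [T] into stars with [p] leaves: [g] sends each point
    to the centre of its star, so the centres are the fixed points. *)
Definition uniform_centring (T : finType) (p : nat) (g : T -> T) : Prop :=
  (forall x, g (g x) = g x) /\ (forall c, g c = c -> #|fibre g c| = p.+1).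

(** For distinct [x] and [y] this is adjacency in the union of the stars of
    [g]; it also holds when [x = y] is a centre. *)
Definition joins (T : eqType) (g : T -> T) (x y : T) : bool :=
  (g x == y) || (g y == x).

Definition star_block (v : nat) (g : 'I_v -> 'I_v) (c : 'I_v)
    : block (complete_graph v) :=
  (fibre g c, [set [set c; x] | x in fibre g c :\ c]).

Definition star_class (v : nat) (g : 'I_v -> 'I_v)
    : {set block (complete_graph v)} :=
  [set star_block g c | c in [set c | g c == c]].

Lemma complete_edge v (x y : 'I_v) :
  ([set x; y] \in edges (complete_graph v)) = (x != y).
Proof.
apply/imset2P/idP => [[a b _]|xy].
  rewrite !inE /= /complete_adj => ab eab.
  apply: contraNneq ab => exy; subst y.
  have: a \in [set x; x] by rewrite eab !inE eqxx.
  have: b \in [set x; x] by rewrite eab !inE eqxx orbT.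
  by rewrite !inE !orbb => /eqP-> /eqP->.
by exists x y; rewrite ?inE.
Qed.

Lemma complete_edgeP v (e : {set 'I_v}) : e \in edges (complete_graph v) ->
  exists x y, x != y /\ e = [set x; y].
Proof. by case/imset2P=> x y _; rewrite inE => /andP[_ xy] ->; exists x, y. Qed.

Lemma star_edgeP n (e : {set 'I_n.+1}) :
  reflect (exists2 i, i != ord0 & e = [set ord0; i]) (e \in edges (star_graph n)).
Proof.
apply: (iffP imset2P) => [[x y _]|[i i0 ->]].
  rewrite !inE /= /star_adj => xy ->; case: (eqVneq x ord0) xy => [->|x0] /= xy.
    by exists y.
  by exists x; rewrite // (eqP xy) setUC.
by exists ord0 i; rewrite // !inE /= /star_adj eqxx /= i0.
Qed.

Lemma edges_star1 : edges (star_graph 1) = edges (complete_graph 2).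
Proof.
apply/setP=> e; apply/star_edgeP/imset2P => [[i i0 ->]|[x y _ xy ->]].
  by exists ord0 i; rewrite ?inE //= /complete_adj eq_sym.
move: xy; rewrite !inE /= /complete_adj => xy.
case: (eqVneq x ord0) xy => [->|x0] xy; first by exists y; rewrite // eq_sym.
have y0 : y = ord0.
  by apply/val_inj; case: x y x0 xy => [[|[|?]] ?] [[|[|?]] ?].
by exists x => //; rewrite y0 setUC.
Qed.

(** This is what allows matchings and star factors to be treated alike. *)
Lemma star1_is_edge v (B : block (complete_graph v)) :
  isomorphic_to (star_graph 1) B -> isomorphic_to (complete_graph 2) B.
Proof. by move=> [f [fI e1 e2]]; exists f; split; rewrite // e2 edges_star1. Qed.

Section OneClass.
Variables (v p : nat) (g : 'I_v -> 'I_v).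
Hypothesis gU : uniform_centring p g.

(** The isomorphism lists the fibre with its centre first, since the centre of
    the model star is [ord0]. *)
Lemma star_block_isomorphic c : g c = c ->
  isomorphic_to (star_graph p) (star_block g c).
Proof.
move=> gc; set s := c :: enum (fibre g c :\ c).
have cF : c \in fibre g c by rewrite inE gc.
have Us : uniq s by rewrite /= mem_enum !inE eqxx enum_uniq.
have sz : size s = p.+1.
  by rewrite /= -cardE -(gU.2 _ gc) (cardsD1 c (fibre g c)) cF.
have mem_s x : (x \in s) = (x \in fibre g c).
  rewrite inE mem_enum in_setD1; case: eqVneq => //= ->; first by rewrite cF.
have fI : injective (fun i : 'I_p.+1 => nth c s i).
  move=> i j /eqP; rewrite nth_uniq ?sz ?ltn_ord // => /eqP; exact: val_inj.
have im x : x \in fibre g c -> exists i : 'I_p.+1, x = nth c s i.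
  rewrite -mem_s => xs; have lt : index x s < p.+1 by rewrite -sz index_mem.
  by exists (Ordinal lt); rewrite nth_index.
exists (fun i : 'I_p.+1 => nth c s i); split => //=.
  apply/setP=> x; apply/idP/imsetP => [/im[i ->]|[i _ ->]]; first by exists i.
  by rewrite -mem_s mem_nth ?sz.
apply/setP=> e; apply/imsetP/imsetP => [[x]|[d /star_edgeP[i i0 ->] ->]].
  rewrite in_setD1 => /andP[xc /im[i ex]] ->.
  exists [set ord0; i]; last by rewrite imsetU1 imset_set1 /= -ex.
  apply/star_edgeP; exists i => //; apply: contraNneq xc => i0.
  by rewrite ex i0.
exists (nth c s i); last by rewrite imsetU1 imset_set1.
by rewrite in_setD1 -mem_s mem_nth ?sz ?ltn_ord // andbT (inj_eq fI i ord0).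
Qed.

Lemma star_classP B :
  reflect (exists2 c, g c = c & B = star_block g c) (B \in star_class g).
Proof.
apply: (iffP imsetP) => [[c]|[c gc ->]]; first by rewrite inE => /eqP; exists c.
by exists c; rewrite // inE gc.
Qed.

Lemma star_block_eq B x : B \in star_class g -> x \in B.1 ->
  B = star_block g (g x).
Proof. by case/star_classP=> c _ -> /=; rewrite inE => /eqP->. Qed.

Lemma star_class_factor : is_factor (star_class g).
Proof.
split=> [B B' BC B'C|].
  apply: contraNT => /pred0Pn[x /andP[/= xB xB']].
  by rewrite (star_block_eq BC xB) (star_block_eq B'C xB').
apply/setP=> x; rewrite inE; apply/bigcupP; exists (star_block g (g x)).
  by apply/star_classP; exists (g x); rewrite ?gU.1.
by rewrite inE.
Qed.

Lemma star_block_subgraph B : B \in star_class g -> is_subgraph B.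
Proof.
case/star_classP=> c gc ->; split=> [|e] /=.
  apply/subsetP=> e /imsetP[x]; rewrite in_setD1 => /andP[xc _] ->.
  by rewrite complete_edge eq_sym.
case/imsetP=> x; rewrite in_setD1 => /andP[_ xF] ->.
by rewrite subUset !sub1set xF inE gc eqxx.
Qed.

Lemma star_class_joins B x y : B \in star_class g -> [set x; y] \in B.2 ->
  joins g x y.
Proof.
case/star_classP=> c gc -> /imsetP[z]; rewrite in_setD1 inE => /andP[zc /eqP gz] e.
have: z \in [set x; y] by rewrite e !inE eqxx orbT.
have: c \in [set x; y] by rewrite e !inE eqxx.
rewrite /joins !inE => /orP[/eqP ec|/eqP ec] /orP[/eqP ez|/eqP ez].
- by rewrite ez ec eqxx in zc.
- by rewrite -ec -ez gz eqxx orbT.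
- by rewrite -ec -ez gz eqxx.
- by rewrite ez ec eqxx in zc.
Qed.

Lemma joins_star_class x y : x != y -> joins g x y ->
  exists2 B, B \in star_class g & [set x; y] \in B.2.
Proof.
wlog gxy : x y / g x = y => [hw xy|xy _].
  case/orP=> /eqP gxy; first by apply: hw; rewrite // /joins gxy eqxx.
  by rewrite setUC; apply: hw; rewrite 1?eq_sym // /joins gxy eqxx.
exists (star_block g y); first by apply/star_classP; exists y; rewrite // -gxy gU.1.
by rewrite setUC; apply/imsetP; exists x; rewrite // !inE xy gxy eqxx.
Qed.

Lemma star_class_edge_inj B B' x y : B \in star_class g -> B' \in star_class g ->
  [set x; y] \in B.2 -> [set x; y] \in B'.2 -> B = B'.
Proof.
move=> BC B'C e e'.
have inV B0 : B0 \in star_class g -> [set x; y] \in B0.2 -> x \in B0.1.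
  case/star_block_subgraph=> _ h /h/subsetP; apply; by rewrite !inE eqxx.
by rewrite (star_block_eq BC (inV _ BC e)) (star_block_eq B'C (inV _ B'C e')).
Qed.

Lemma star_class_block_edge B : 0 < p -> B \in star_class g ->
  exists x y, x != y /\ [set x; y] \in B.2.
Proof.
move=> p0 /star_classP[c gc ->].
have cF : c \in fibre g c by rewrite inE gc.
have /card_gt0P[x xF] : 0 < #|fibre g c :\ c|.
  by have:= gU.2 _ gc; rewrite (cardsD1 c) cF add1n => -[->].
exists c, x; split; last by apply/imsetP; exists x.
by move: xF; rewrite !inE eq_sym => /andP[].
Qed.

Lemma star_class_neq0 : 0 < v -> star_class g != set0.
Proof.
move=> v0; apply/set0Pn; exists (star_block g (g (Ordinal v0))).
by apply/star_classP; eexists; last reflexivity; rewrite gU.1.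
Qed.

End OneClass.

(** * From exact covers by centre maps to decompositions *)

(** Since each pair of vertices is joined by exactly one map of the family, an
    edge determines its class, and inside the class it determines its block by
    vertex-disjointness. Blocks have edges and classes have blocks, so distinct
    indices give distinct classes, and their number is that of the indices. *)
Lemma URD_of_centrings (v n : nat) (I1 I2 : finType) (h : I1 + I2 -> 'I_v -> 'I_v) :
  0 < v -> 0 < n ->
  (forall i, uniform_centring 1 (h (inl i))) ->
  (forall i, uniform_centring n (h (inr i))) ->
  (forall x y, x != y -> exists! i, joins (h i) x y) ->
  URD (complete_graph 2) (star_graph n) (complete_graph v) #|I1| #|I2|.
Proof.
move=> v0 n0 hU1 hU2 h_col.
pose leaves (i : I1 + I2) := if i is inl _ then 1 else n.
have hU i : uniform_centring (leaves i) (h i) by case: i.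
have leaves_gt0 i : 0 < leaves i by case: i.
pose cl i := star_class (h i).
have cl_col i i' B B' x y : B \in cl i -> B' \in cl i' ->
    [set x; y] \in B.2 -> [set x; y] \in B'.2 -> i = i'.
  move=> BC B'C e e'.
  have xy : x != y.
    have [/subsetP sub _] := star_block_subgraph BC.
    by rewrite -complete_edge sub.
  have [i0 [_ i0_uniq]] := h_col x y xy.
  by rewrite -(i0_uniq i (star_class_joins BC e)) (i0_uniq i' (star_class_joins B'C e')).
have cl_inj i i' B : B \in cl i -> B \in cl i' -> i = i'.
  move=> BC B'C; have [x [y [_ e]]] := star_class_block_edge (hU i) (leaves_gt0 i) BC.
  exact: (cl_col _ _ _ _ _ _ BC B'C e e).
have cl_neq0 i : cl i != set0 by exact: star_class_neq0 (hU i) v0.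
have clI : injective cl.
  move=> i i' e; have /set0Pn[B BC] := cl_neq0 i.
  by apply: (cl_inj _ _ B) => //; rewrite -e.
pose D := \bigcup_i cl i.
have DP B : reflect (exists i, B \in cl i) (B \in D).
  by apply: (iffP bigcupP) => [[i _]|[i]]; exists i.
have D_edge x y : x != y -> exists! B, B \in D /\ [set x; y] \in B.2.
  move=> xy; have [i [ixy _]] := h_col x y xy.
  have [B BC e] := joins_star_class (hU i) xy ixy.
  exists B; split=> [|B' [/DP[i' B'C] e']]; first by split=> //; apply/DP; exists i.
  have ii' := cl_col _ _ _ _ _ _ BC B'C e e'; subst i'.
  exact: (star_class_edge_inj BC B'C e e').
pose P1 := [set cl (inl i) | i : I1]; pose P2 := [set cl (inr i) | i : I2].
have PP C : reflect (exists i, C = cl i) (C \in P1 :|: P2).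
  apply: (iffP setUP) => [[] /imsetP[i _ ->]|[[i|i] ->]].
  - by exists (inl i).
  - by exists (inr i).
  - by left; apply: imset_f.
  - by right; apply: imset_f.
exists D, P1, P2; split.
- split.
  + by move=> B /DP[i]; apply: star_block_subgraph.
  + move=> B /DP[[i|i] /star_classP[c gc ->]]; [left|right].
      exact/star1_is_edge/(star_block_isomorphic (hU (inl i))).
    exact: (star_block_isomorphic (hU (inr i))).
  + move=> B B' BD B'D; apply: contraNT => /pred0Pn[e /andP[/= eB eB']].
    have [i /star_block_subgraph[/subsetP sub _]] := DP _ BD.
    have [x [y [xy exy]]] := complete_edgeP (sub _ eB); subst e.
    have [B0 [_ B0u]] := D_edge x y xy.
    by rewrite -(B0u B) // -(B0u B').
  + by move=> e /complete_edgeP[x [y [xy ->]]]; apply: D_edge.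
- split; last first.
    apply/pred0P=> C /=; apply/negP=> /andP[/imsetP[i _ ->] /imsetP[i' _ /clI]].
    by [].
  apply/and3P; split.
  + apply/eqP/setP=> B; apply/bigcupP/DP => [[C /PP[i ->]]|[i BC]]; first by exists i.
    by exists (cl i) => //; apply/PP; exists i.
  + apply/trivIsetP=> C C' /PP[i ->] /PP[i' ->]; apply: contraNT.
    by case/pred0Pn=> B /andP[/= /cl_inj h1 /h1 ->].
  + by apply/PP=> -[i e]; have:= cl_neq0 i; rewrite -e eqxx.
- by move=> C /PP[i ->]; apply: (star_class_factor (hU i)).
- split; first by rewrite card_imset // => i i' /clI[].
  move=> C B /imsetP[i _ ->] /star_classP[c gc ->].
  exact/star1_is_edge/(star_block_isomorphic (hU (inl i))).
- split; first by rewrite card_imset // => i i' /clI[].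
  move=> C B /imsetP[i _ ->] /star_classP[c gc ->].
  exact: (star_block_isomorphic (hU (inr i))).
Qed.

(** Transport along an enumeration, so that the maps can be given on any vertex
    set. *)
Lemma URD_of_centrings_on (V I1 I2 : finType) (n : nat) (h : I1 + I2 -> V -> V) :
  0 < #|V| -> 0 < n ->
  (forall i, uniform_centring 1 (h (inl i))) ->
  (forall i, uniform_centring n (h (inr i))) ->
  (forall x y, x != y -> exists! i, joins (h i) x y) ->
  URD (complete_graph 2) (star_graph n) (complete_graph #|V|) #|I1| #|I2|.
Proof.
move=> V0 n0 hU1 hU2 h_col.
pose h' i (x : 'I_#|V|) := enum_rank (h i (enum_val x)).
have h'U p i : uniform_centring p (h i) -> uniform_centring p (h' i).
  case=> idem size_fibre; split=> [x|c]; first by rewrite /h' enum_rankK idem.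
  move=> /(congr1 enum_val); rewrite enum_rankK => /size_fibre <-.
  rewrite -(card_imset _ (@enum_rank_inj V)); apply: eq_card => x.
  apply/idP/imsetP => [|[y]]; rewrite !inE /h'.
    move=> /eqP <-; exists (enum_val x); last by rewrite enum_valK.
    by rewrite inE enum_rankK.
  by move=> /eqP hy ->; rewrite enum_rankK hy enum_valK.
apply: (@URD_of_centrings _ _ _ _ h') => // [i|i|x y xy]; try exact: h'U.
have [|i [ixy i_uniq]] := h_col (enum_val x) (enum_val y).
  by rewrite (inj_eq enum_val_inj).
have joinsE j : joins (h' j) x y = joins (h j) (enum_val x) (enum_val y).
  by rewrite /joins -!(inj_eq enum_val_inj) !enum_rankK.
by exists i; split=> [|j]; rewrite joinsE //; apply: i_uniq.
Qed.

(** * Perfect matchings as involutions *)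

Section Involution.
Variables (T : finType) (f : T -> T).
Hypotheses (fK : involutive f) (f_neq : forall x, f x != x).

(** Chooses one end in each pair [{x, f x}]: it serves as the centre of the pair,
    and as the side that tells apart the two slanted one-factors of a matching. *)
Definition is_first (x : T) : bool := enum_rank x < enum_rank (f x).

Definition first_of_pair (x : T) : T := if is_first x then x else f x.

Lemma is_first_swap x : is_first (f x) = ~~ is_first x.
Proof.
rewrite /is_first fK -leqNgt ltn_neqAle andb_idl // => _.
by rewrite (inj_eq val_inj) (inj_eq enum_rank_inj).
Qed.

Lemma is_first_first_of_pair x : is_first (first_of_pair x).
Proof. by rewrite /first_of_pair; case: ifPn => //; rewrite is_first_swap. Qed.

Lemma first_of_pair_swap x : first_of_pair (f x) = first_of_pair x.
Proof. by rewrite /first_of_pair is_first_swap fK; case: is_first. Qed.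

Lemma uniform_centring_first_of_pair : uniform_centring 1 first_of_pair.
Proof.
split=> [x|c gc]; first by rewrite {1}/first_of_pair is_first_first_of_pair.
have -> : fibre first_of_pair c = [set c; f c].
  apply/setP=> x; rewrite !inE; apply/eqP/orP => [<-|].
    by rewrite /first_of_pair; case: ifP; rewrite ?fK eqxx; auto.
  by case=> /eqP->; rewrite ?first_of_pair_swap.
by rewrite cards2 eq_sym f_neq.
Qed.

Lemma joins_first_of_pair x y : x != y -> joins first_of_pair x y = (f x == y).
Proof.
move=> xy; rewrite /joins; apply/idP/eqP => [|<-]; last first.
  rewrite first_of_pair_swap /first_of_pair.
  by case: is_first; rewrite eqxx ?orbT.
rewrite /first_of_pair => /orP[]; case: ifP => _; rewrite ?(negbTE xy) //.
- by move/eqP.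
- by rewrite eq_sym (negbTE xy).
- by move/eqP <-; rewrite fK.
Qed.

End Involution.

(** * Colourings from groups of odd order *)

Definition one_factorization (K J : finType) (M : K -> J -> J) : Prop :=
  [/\ forall k, involutive (M k), forall k j, M k j != j
    & forall j j', j != j' -> exists! k, M k j = j'].

Section OddGroup.
Import GRing.Theory.
Local Open Scope ring_scope.

(** Twice [x - y] is zero, and so is its multiple by the odd order of [Z]. *)
Lemma double_inj (Z : finZmodType) : odd #|Z| -> injective (fun z : Z => z + z).
Proof.
move=> oddZ x y /= e; apply/eqP; rewrite -subr_eq0; set z := x - y.
have z2 : z *+ 2 = 0 by rewrite mulr2n /z addrACA e -opprD subrr.
have /eqP: z *+ #|Z| = 0.
  by have := @expg_cardG Z [set: Z]%G z (in_setT z); rewrite cardsT.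
by rewrite -[#|Z|]odd_double_half oddZ -mul2n mulrnDr mulrnA z2 mul0rn addr0 mulr1n.
Qed.

(** The edge [{i, j}] of [Z] gets colour [i + j], and the edge from [i] to the
    added point [None] gets colour [i + i], the one colour missing at [i]. As
    doubling is bijective, each colour occurs exactly once at [None]. *)
Lemma one_factorization_option (Z : finZmodType) : odd #|Z| ->
  exists M : Z -> option Z -> option Z, one_factorization M.
Proof.
move=> oddZ; have dblI := double_inj oddZ.
pose half := invF dblI.
have halfK k : half k + half k = k := f_invF dblI k.
have dblK i : half (i + i) = i := invF_f dblI i.
exists (fun k j => if j is Some i then if i + i == k then None else Some (k - i)
                   else Some (half k)).
split=> [k [i|]|k [i|]|].
- case: eqP => [<-|ik]; first by rewrite dblK.
  rewrite ifF; first by rewrite opprB addrC subrK.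
  by apply/eqP=> e; apply: ik; apply: (addrI k); rewrite -{1}e addrACA !subrK.
- by rewrite halfK eqxx.
- case: ifPn => // ik; apply: contra ik => /eqP[e].
  by rewrite -{2}e addrC subrK.
- by [].
- move=> [i|] [j|] ij //.
  + exists (i + j); split=> [|k].
      rewrite (inj_eq (addrI i)); case: eqP => [e|_]; first by rewrite e eqxx in ij.
      by rewrite addrC addKr.
    by case: ifP => // _ [<-]; rewrite addrC subrK.
  + by exists (i + i); split=> [|k]; [rewrite eqxx|case: eqP].
  + by exists (j + j); split=> [|k [<-]]; rewrite ?dblK ?halfK.
Qed.

Definition signed (V : zmodType) (s : bool) (z : V) : V := if s then z else - z.

Lemma signedN (V : zmodType) s (z : V) : signed (~~ s) z = - signed s z.
Proof. by case: s; rewrite /signed //= opprK. Qed.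

Definition half_system (D : finType) (X : zmodType) (delta : D -> X) : Prop :=
  (forall d, delta d != 0) /\
  (forall z, z != 0 -> exists! ds, signed ds.2 (delta ds.1) = z).

(** * The factors on the grid *)

Section Construction.
Variables (X : finZmodType) (D1 D2 : finType) (delta : D1 + D2 -> X).
Variables (K J : finType) (M : K -> J -> J) (k0 : K).
Hypotheses (deltaP : half_system delta) (MP : one_factorization M).

Let MK k : involutive (M k). Proof. by case: MP. Qed.
Let M_neq k j : M k j != j. Proof. by case: MP. Qed.
Let M_ex j j' : j != j' -> exists! k, M k j = j'. Proof. by case: MP => _ _; apply. Qed.

(** Moves forward by [delta d] the ends of the matching [M k] on side [b], and
    backward the others. *)
Definition slant (dkb : D1 * K * bool) (u : X * J) : X * J :=
  let: (d, k, b) := dkb in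
  (u.1 + signed (is_first (M k) u.2 == b) (delta (inl d)), M k u.2).

Definition reflect_row (a : X) (u : X * J) : X * J :=
  if a - u.1 == u.1 then (u.1, M k0 u.2) else (a - u.1, u.2).

Definition within_column (k : {k : K | k != k0}) (u : X * J) : X * J :=
  (u.1, M (val k) u.2).

Definition star_centre (dc : D2 * J) (u : X * J) : X * J :=
  (if u.2 == dc.2 then u.1 else u.1 - delta (inr dc.1), dc.2).

Definition matching (i : D1 * K * bool + (X + {k : K | k != k0})) : X * J -> X * J :=
  match i with
  | inl dkb => slant dkb
  | inr (inl a) => reflect_row a
  | inr (inr k) => within_column k
  end.

Lemma delta_signed_neq0 s d : signed s (delta d) != 0.
Proof. by case: s; rewrite /= ?oppr_eq0 deltaP.1. Qed.

Lemma matchingK i : involutive (matching i).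
Proof.
case: i => [[[d k] b]|[a|k]] [x j] /=.
- rewrite MK is_first_swap //; congr (_, _).
  rewrite (_ : (~~ _ == b) = ~~ (is_first (M k) j == b)) ?signedN ?addrK //.
  by case: is_first; case: b.
- rewrite /reflect_row /=; have [ax|ax] := boolP (a - x == x) => /=.
    by rewrite ax MK.
  by rewrite opprB addrC subrK eq_sym (negbTE ax).
- by rewrite /within_column /= MK.
Qed.

Lemma matching_neq i u : matching i u != u.
Proof.
case: i u => [[[d k] b]|[a|k]] [x j] /=.
- by rewrite xpair_eqE (negbTE (M_neq k j)) andbF.
- rewrite /reflect_row /=; case: ifPn => ax; rewrite xpair_eqE.
    by rewrite (negbTE (M_neq k0 j)) andbF.
  by rewrite (negbTE ax).
- by rewrite xpair_eqE (negbTE (M_neq _ j)) andbF.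
Qed.

Lemma uniform_centring_star_centre n dc : #|J| = n.+1 ->
  uniform_centring n (star_centre dc).
Proof.
case: dc => d c cardJ; split=> [[x j]|[x j] /= [_ <-]].
  by rewrite /star_centre /= eqxx.
pose leaf (i : J) := (if i == c then x else x + delta (inr d), i).
have leafI : injective leaf by move=> i i' [].
rewrite -cardJ -(card_imset _ leafI) /fibre; apply: eq_card => -[y i].
rewrite inE /star_centre /= xpair_eqE eqxx andbT.
apply/eqP/imsetP => [yx|[i' _ [-> ->]]]; last by case: (i' == c); rewrite ?addrK.
by exists i; rewrite // /leaf -yx; case: (i == c); rewrite ?subrK.
Qed.

Definition centre_map (i : D1 * K * bool + (X + {k : K | k != k0}) + D2 * J) :
    X * J -> X * J :=
  match i with
  | inl i => first_of_pair (matching i)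
  | inr dc => star_centre dc
  end.

(** The sign [s] tells which of the two points is the centre: the first one if
    the difference of the columns is [delta d], the second one if it is
    [- delta d]. *)
Lemma joins_star_centre dc x y j j' : (x, j) != (y, j') ->
  joins (star_centre dc) (x, j) (y, j') <->
  j != j' /\ exists s, signed s (delta (inr dc.1)) = y - x /\ dc.2 = if s then j else j'.
Proof.
case: dc => d c /= uw; rewrite /joins /star_centre /= !xpair_eqE; split.
  case/orP=> /andP[/eqP e /eqP ec]; subst c; rewrite xpair_eqE in uw.
    case: ifPn e => [/eqP jj e|jj e]; first by rewrite e jj !eqxx in uw.
    by split=> //; exists false; rewrite -e addrAC subrr add0r.
  rewrite eq_sym; case: ifPn e => [/eqP jj e|jj e]; first by rewrite e jj !eqxx in uw.
  by split=> //; exists true; rewrite -e opprB addrC subrK.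
case=> jj' [s [e ->]]; case: s e => /= e; apply/orP; [right|left].
  by rewrite [j' == j]eq_sym (negbTE jj') e opprB addrC subrK !eqxx.
by rewrite (negbTE jj') e addrC subrK !eqxx.
Qed.

(** The pair determines its map. In one column, the colour of the two rows is
    [k0] or not, which selects a reflection or a within-column matching. In one
    row, the sum of the columns selects the reflection. Otherwise the pair is
    slanted, and the signed difference of its columns selects [d]; for a star
    the sign then selects the centre row, and for a matching the colour of the
    two rows selects [k], and the sign the side [b]. *)
Lemma centre_map_exact_cover u w : u != w -> exists! i, joins (centre_map i) u w.
Proof.
move=> uw.
pose rel i := match i with inl i => matching i u = w
                         | inr dc => joins (star_centre dc) u w end.
suff [i [iuw i_uniq]] : exists! i, rel i.
  have relE i' : joins (centre_map i') u w <-> rel i'.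
    case: i' => [i'|//] /=.
    by rewrite (joins_first_of_pair (matchingK i') (matching_neq i')) //; split=> /eqP.
  by exists i; split=> [|i' /relE]; [apply/relE|apply: i_uniq].
(* [rel] is kept as a local definition, so that it computes on each index. *)
case: u w @rel uw => [x j] [y j'] rel uw.
have nostar : x = y \/ j = j' -> forall dc, ~ joins (star_centre dc) (x, j) (y, j').
  move=> xyjj dc /(joins_star_centre _ uw)[jj' [s [e _]]].
  case: xyjj => [xy|ejj]; last by rewrite ejj eqxx in jj'.
  by have := delta_signed_neq0 s (inr dc.1); rewrite e xy subrr eqxx.
have noslant : x = y \/ j = j' -> forall dkb, slant dkb (x, j) <> (y, j').
  move=> xyjj [[d k] b] [e1 e2]; case: xyjj => [xy|jj].
    have := delta_signed_neq0 (is_first (M k) j == b) (inl d).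
    by rewrite -(inj_eq (addrI x)) e1 xy addr0 eqxx.
  by have := M_neq k j; rewrite e2 jj eqxx.
have [xy|xy] := eqVneq x y; last have [jj|jj] := eqVneq j j'.
- subst y; have jj : j != j' by move: uw; rewrite xpair_eqE eqxx.
  have [k [kj k_uniq]] := M_ex jj.
  have row a : reflect_row a (x, j) = (x, j') -> a = x + x /\ k0 = k.
    rewrite /reflect_row /=; case: eqP => [ax [kk]|_ [_ e]]; last by rewrite e eqxx in jj.
    by rewrite -{2}ax addrC subrK (k_uniq _ kk).
  have [kk0|kk0] := eqVneq k k0.
    exists (inl (inr (inl (x + x)))); split=> [|[[dkb|[a|k']]|dc]] /=.
    + by rewrite /reflect_row /= addrK eqxx -kk0 kj.
    + by move/noslant; case; left.
    + by case/row=> ->.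
    + by case=> /k_uniq kk'; have:= valP k'; rewrite /= -kk' kk0 eqxx.
    + by move/nostar; case; left.
  exists (inl (inr (inr (Sub k kk0)))); split=> [|[[dkb|[a|k']]|dc]] /=.
  + by rewrite /within_column /= kj.
  + by move/noslant; case; left.
  + by case/row=> _ kE; case/eqP: kk0.
  + by case=> /k_uniq kk'; congr (inl (inr (inr _))); apply/val_inj.
  + by move/nostar; case; left.
- subst j'; exists (inl (inr (inl (x + y)))); split=> [|[[dkb|[a|k']]|dc]] /=.
  + by rewrite /reflect_row /= addrAC subrr add0r eq_sym (negbTE xy).
  + by move/noslant; case; right.
  + rewrite /reflect_row /=; case: eqP => [_ [e]|_ [<-]]; first by rewrite e eqxx in xy.
    by rewrite addrC subrK.
  + by case=> e; rewrite e eqxx in xy.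
  + by move/nostar; case; right.
have yx : y - x != 0 by rewrite subr_eq0 eq_sym.
have [[e s] [/= es es_uniq]] := deltaP.2 _ yx.
have [k [kj k_uniq]] := M_ex jj.
have slantP d k' b : slant (d, k', b) (x, j) = (y, j') ->
    (e, s) = (inl d, is_first (M k) j == b) /\ k' = k.
  case=> e1 /k_uniq kk; subst k'; split=> //; apply: es_uniq.
  by rewrite /= -e1 addrC addKr.
have starP dc : joins (star_centre dc) (x, j) (y, j') ->
    e = inr dc.1 /\ dc.2 = if s then j else j'.
  move/(joins_star_centre _ uw) => [_ [s' [e1 e2]]].
  by have [-> ->] : (e, s) = (inr dc.1, s') by apply: es_uniq.
have norow a : reflect_row a (x, j) <> (y, j').
  rewrite /reflect_row /=; case: eqP => _ [e1 e2]; first by rewrite e1 eqxx in xy.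
  by rewrite e2 eqxx in jj.
have nocol k' : within_column k' (x, j) <> (y, j').
  by case=> e1; rewrite e1 eqxx in xy.
case: e es es_uniq slantP starP => [d|d] es _ slantP starP.
  exists (inl (inl (d, k, is_first (M k) j == s))); split=> [|[[[[d' k'] b]|[a|k']]|dc]] /=.
  + rewrite kj; congr (_, _).
    by rewrite (_ : (_ == _) = s) ?es 1?addrC ?subrK //; case: s {es slantP starP}; case: is_first.
  + by case/slantP=> -[-> ->] ->; case: is_first; case: b.
  + by move/norow.
  + by move/nocol.
  + by case/starP.
exists (inr (d, if s then j else j')); split=> [|[[[[d' k'] b]|[a|k']]|dc]] /=.
+ by apply/(joins_star_centre _ uw); split=> //; exists s.
+ by case/slantP.
+ by move/norow.
+ by move/nocol.
+ by case/starP; case: dc => d' c /= [->] ->.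
Qed.

End Construction.

(** The elements 1, ..., k modulo 2k + 1; their opposites are k + 1, ..., 2k. The
    index set is a sum so that the first [l] of them can be treated apart. *)
Lemma half_system_ord (p l k : nat) : p = k.*2 -> (l <= k)%N ->
  exists delta : 'I_l + 'I_(k - l) -> 'I_p.+1, half_system delta.
Proof.
move=> pk lk; pose delta (e : 'I_l + 'I_(k - l)) : 'I_p.+1 := inZp (unsplit e).+1.
have idx_lt e : (@unsplit l (k - l) e < k)%N.
  have := ltn_ord (@unsplit l (k - l) e); lia.
have signed_val s e : signed s (delta e) =
    (if s then (unsplit e).+1 else p - unsplit e)%N :> nat.
  have lt := idx_lt e; case: s => /=; first by rewrite modn_small //; lia.
  by rewrite (modn_small (m := _.+1)) ?subSS ?modn_small; lia.
exists delta; split=> [e|z z0].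
  rewrite -val_eqE /= modn_small //; have := idx_lt e; lia.
have zp := ltn_ord z; have {}z0 : (0 < z)%N by rewrite lt0n -val_eqE in z0 *.
pose t := (if z <= k then z.-1 else p - z)%N.
have tk : (t < l + (k - l))%N by rewrite /t subnKC //; case: ifP; lia.
exists (split (Ordinal tk), (z <= k)%N); split=> /= [|[e s]].
  by apply/ord_inj; rewrite signed_val splitK /= /t; case: (leqP z k); lia.
move=> /(congr1 (@nat_of_ord _)) /=; rewrite signed_val => ez; have lt := idx_lt e.
have -> : (z <= k)%N = s by case: (s) ez; lia.
congr (_, _); apply: (can_inj (@unsplitK l (k - l))); rewrite splitK.
by apply/ord_inj; rewrite /= /t; case: s ez; case: (leqP z k); lia.
Qed.

End OddGroup.

(** * The decomposition of the complete graph *)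

Theorem theorem5p1 (n m v : nat) :
  3 <= n -> odd n -> 3 <= m -> odd m -> v = m * (n + 1) ->
  forall l r s : nat,
    l <= (m - 1)./2 ->
    r = 2 * n * l + (m + n - 1) ->
    s = (n + 1) * ((m - 1)./2 - l) ->
    URD (complete_graph 2) (star_graph n) (complete_graph v) r s.
Proof.
case: n m => [//|q] [//|p] q3 oddn p3 oddm -> l r s lk -> ->.
have [delta deltaP] : exists delta : 'I_l + 'I_((p.+1 - 1)./2 - l) -> 'I_p.+1,
    half_system delta.
  by apply: half_system_ord => //; move: oddm; lia.
have [|M MP] := @one_factorization_option 'I_q.+1; first by rewrite card_ord.
pose h := @centre_map _ _ _ delta _ _ M ord0.
have := @URD_of_centrings_on _ _ _ q.+1 h.
rewrite !card_sum !card_prod card_bool card_sig cardC1 card_option !card_ord.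
set r' := (_ + (_ + _)); set s' := (_ - l) * _.
have -> : r' = 2 * q.+1 * l + (p.+1 + q.+1 - 1) by rewrite /r'; lia.
have -> : s' = (q.+1 + 1) * ((p.+1 - 1)./2 - l) by rewrite /s'; lia.
rewrite addn1; apply=> // [i|i|].
- exact: uniform_centring_first_of_pair (matchingK _ MP _) (matching_neq _ MP _).
- by apply: uniform_centring_star_centre; rewrite card_option card_ord.
- exact: centre_map_exact_cover.
Qed.
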